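(* Let $G$ be a connected half-transitive multigraph with bipartition $V_1\cup V_2$. Assume each vertex in $V_1$ has degree $d_1$ and each vertex in $V_2$ has degree $d_2$ in $G$. Then $G$ is not maximally edge-connected if and only if there is a proper induced connected half-transitive multi-subgraph $H$ of $G$, with $A_1=V_1\cap V(H)$ and $A_2=V_2\cap V(H)$ both non-empty, such that $$d_1'<d_1,\quad d_2'<d_2\quad\text{and}\quad |A_1|(d_1-d_1')+|A_2|(d_2-d_2')\leq \min\{d_1,d_2\}-1,$$ where $d_1'$ is the degree in $H$ of each vertex of $A_1$ and $d_2'$ is the degree in $H$ of each vertex of $A_2$.
   Context: Graphs are finite. A multigraph may have multiple edges but has no loops (simple graphs are allowed); the degree of a vertex counts edges with multiplicity. An automorphism of a multigraph is a permutation of its vertex set preserving the number of edges between every pair of vertices. A bipartite multigraph with bipartition $V_1\cup V_2$ (both parts non-empty) is half-transitive if its automorphism group acts transitively both on $V_1$ and on $V_2$, i.e. for each $i\in\{1,2\}$ and all $u,v\in V_i$ there is an automorphism $\alpha$ with $\alpha(u)=v$. All vertices in the same part then have the same degree. For an induced multi-subgraph $H$ of $G$, half-transitivity is with respect to the bipartition $(V_1\cap V(H))\cup(V_2\cap V(H))$; proper induced means $H=G[A]$ for some $A\subsetneq V(G)$, all edges of $G$ between vertices of $A$ being kept with their multiplicities. The edge-connectivity $\lambda(G)$ is the minimum number of edges (counted with multiplicity) whose removal disconnects $G$; $\delta(G)$ is the minimum degree. $G$ is maximally edge-connected if $\lambda(G)=\delta(G)$. *)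

(* Defs.v *)
From HB Require Import structures.
From mathcomp Require Import all_boot all_fingroup.
Set Implicit Arguments.
Unset Strict Implicit.
Unset Printing Implicit Defensive.

(* [ends e] is the unordered pair of end-vertices of [e]: having exactly two
   elements rules out loops, and [ends] need not be injective, so parallel
   edges are allowed. *)
Record multigraph := Multigraph {
  vertex : finType;
  edge : finType;
  ends : edge -> {set vertex};
  card_ends : forall e, #|ends e| == 2
}.
Arguments ends {m} e.

Definition multiplicity (G : multigraph) (u v : vertex G) : nat :=
  #|[set e : edge G | ends e == [set u; v]]|.

Definition degree (G : multigraph) (v : vertex G) : nat :=
  #|[set e : edge G | v \in ends e]|.

Definition adjacent (G : multigraph) : rel (vertex G) :=
  fun u v => 0 < multiplicity u v.

Definition connected (G : multigraph) : bool :=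
  (0 < #|vertex G|) && [forall u, forall v, connect (@adjacent G) u v].

Definition automorphism (G : multigraph) (s : {perm (vertex G)}) : Prop :=
  forall u v : vertex G, multiplicity (s u) (s v) = multiplicity u v.

Definition bipartition (G : multigraph) (V1 V2 : {set vertex G}) : Prop :=
  [/\ V1 != set0, V2 != set0, [disjoint V1 & V2], V1 :|: V2 = setT
    & forall e : edge G, #|ends e :&: V1| = 1 /\ #|ends e :&: V2| = 1].

Definition aut_transitive_on (G : multigraph) (W : {set vertex G}) : Prop :=
  forall u v : vertex G, u \in W -> v \in W ->
    exists2 s : {perm (vertex G)}, automorphism s & s u = v.

Definition half_transitive (G : multigraph) (V1 V2 : {set vertex G}) : Prop :=
  [/\ bipartition V1 V2, aut_transitive_on V1 & aut_transitive_on V2].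

Section Subgraphs.
Variable G : multigraph.

Definition induced_ends (A : {set vertex G})
    (e : {e : edge G | ends e \subset A}) : {set {x : vertex G | x \in A}} :=
  [set x | val x \in ends (val e)].

Fact card_induced_ends A e : #|@induced_ends A e| == 2.
Proof.
rewrite -(card_imset _ val_inj) -(eqP (card_ends (val e))).
apply/eqP; congr #|pred_of_set _|; apply/setP=> x; apply/imsetP/idP.
  by case=> y; rewrite inE => yP ->.
move=> xe; have xA := subsetP (valP e) x xe.
by exists (exist (fun x => x \in A) x xA); rewrite ?inE.
Qed.

Definition induced (A : {set vertex G}) : multigraph :=
  Multigraph (@card_induced_ends A).

Definition trace (A W : {set vertex G}) : {set vertex (induced A)} :=
  [set x : vertex (induced A) | val x \in W].

Definition delete_edges (F : {set edge G}) : multigraph :=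
  @Multigraph (vertex G) {e : edge G | e \notin F}
    (fun e => ends (val e)) (fun e => card_ends (val e)).

End Subgraphs.

(* The neutral value #|edge G| of the two minima below is never smaller than
   the true minimum: deleting all edges disconnects any graph with at least two
   vertices, and every degree is at most #|edge G| as there are no loops. *)
Definition edge_connectivity (G : multigraph) : nat :=
  \big[minn/#|edge G|]_(F : {set edge G} | ~~ connected (delete_edges F)) #|F|.

Definition min_degree (G : multigraph) : nat :=
  \big[minn/#|edge G|]_(v : vertex G) degree v.

Definition maximally_edge_connected (G : multigraph) : Prop :=
  edge_connectivity G = min_degree G.

(* Main.v *)
Require Import Defs.
From mathcomp Require Import all_boot all_fingroup.
Set Implicit Arguments.
Unset Strict Implicit.
Unset Printing Implicit Defensive.

(** If some proper vertex set [A] spans a submultigraph [H] as described, then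
    the edges leaving [A] number |A1|(d1 - d1') + |A2|(d2 - d2') < min(d1, d2),
    which is the minimum degree; deleting them disconnects [G], so [G] is not
    maximally edge-connected.

    Conversely, let the edge-connectivity be below the minimum degree, and let
    [A] be an atom: a vertex set of least size among those whose boundary is a
    minimum edge cut.  Submodularity of the boundary function shows that two
    atoms that meet are equal ([atoms_meet_eq]), so atoms are blocks for the
    automorphism group: an automorphism carrying one vertex of [A] into [A]
    fixes [A] setwise and restricts to [H = G[A]].  Hence [H] inherits
    transitivity on both sides ([atom_aut_transitive]).  Minimality of [A] makes
    [H] connected ([atom_induced_connected]), and [A] meets both parts, for a
    set inside one part has a boundary of at least the minimum degree
    ([small_boundary_meets]).

    What remains is that the degrees drop strictly in both parts
    ([atom_out_neighbour]).  Were all neighbours of some vertex of [A] in V1 to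
    lie in [A], transitivity on V1 would place each vertex of V1, together with
    all its neighbours, in an atom.  Every edge has an end in V1, so every edge
    would lie inside an atom; as atoms are disjoint no edge could leave [A],
    contradicting connectedness.  The numerical bound is again the count of the
    edges leaving [A] ([card_boundary_induced]). *)

(** * Edge cuts *)

Definition boundary (G : multigraph) (A : {set vertex G}) : {set edge G} :=
  [set e | ~~ (ends e \subset A) && ~~ [disjoint ends e & A]].

Lemma ends_pair (G : multigraph) (e : edge G) :
  exists x y, x != y /\ ends e = [set x; y].
Proof. exact/cards2P/card_ends. Qed.

Lemma boundary_pair (G : multigraph) (A : {set vertex G}) (e : edge G) x y :
  ends e = [set x; y] -> (e \in boundary A) = (x \in A) (+) (y \in A).
Proof.
move=> exy; rewrite inE exy subUset !sub1set -setI_eq0 setIUl setU_eq0.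
by rewrite !setI_eq0 !disjoints1; case: (x \in A) (y \in A) => [] [].
Qed.

Lemma boundaryP (G : multigraph) (A : {set vertex G}) (e : edge G) :
  reflect (exists x y, [/\ x \in A, y \notin A & ends e = [set x; y]])
          (e \in boundary A).
Proof.
apply: (iffP idP) => [|[x [y [xA yA exy]]]]; last first.
  by rewrite (boundary_pair A exy) xA (negbTE yA).
case: (ends_pair e) => x [y] [_ exy]; rewrite (boundary_pair A exy).
case xA: (x \in A); case yA: (y \in A) => // _.
  by exists x, y; rewrite xA yA.
by exists y, x; rewrite xA yA setUC.
Qed.

Lemma multiplicity_gt0P (G : multigraph) (x y : vertex G) :
  reflect (exists e : edge G, ends e = [set x; y]) (0 < multiplicity x y).
Proof.
apply: (iffP card_gt0P) => -[e]; first by rewrite inE => /eqP; exists e.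
by move=> exy; exists e; rewrite inE exy.
Qed.

Lemma multiplicity_diag (G : multigraph) (x : vertex G) : multiplicity x x = 0.
Proof.
apply/eqP; rewrite -leqn0 leqNgt; apply/multiplicity_gt0P=> -[e exx].
by have := card_ends e; rewrite exx setUid cards1.
Qed.

Lemma boundary1 (G : multigraph) (v : vertex G) : #|boundary [set v]| = degree v.
Proof.
apply: eq_card => e; rewrite [RHS]inE.
case: (ends_pair e) => x [y] [xy exy].
rewrite (boundary_pair _ exy) exy !inE !(eq_sym v).
by case: (x =P v) xy => [->|_]; case: (y =P v) => [->|_] //; rewrite eqxx.
Qed.

(** Only multiplicities are visible to automorphisms, so edge cuts have to be
    counted by pairs of vertices; each edge of the boundary is counted once
    because exactly one of its ends lies in [A]. *)
Lemma card_boundary (G : multigraph) (A : {set vertex G}) :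
  #|boundary A| = \sum_(u in A) \sum_(v in ~: A) multiplicity u v.
Proof.
transitivity (\sum_e \sum_(p | (p.1 \in A) && (p.2 \in ~: A))
                 (ends e == [set p.1; p.2])).
  rewrite -sum1_card big_mkcond /=; apply: eq_bigr => e _.
  case: boundaryP => [[x [y [xA yA exy]]]|nb].
    rewrite (bigD1 (x, y)) /= ?xA ?inE ?yA // exy eqxx big1 // => -[u v] /=.
    rewrite inE => /andP[/andP[uA vA] neq]; apply/eqP; rewrite eqb0.
    apply: contraNN neq => /eqP/setP E.
    have := E u; have := E v; rewrite !inE !eqxx orbT /=.
    case: (v =P x) vA => [->|_ _ /orP]; first by rewrite xA.
    case=> // /eqP ->.
    by case: (u =P y) uA => [->|_ _ /orP]; [rewrite (negbTE yA) | case=> // /eqP ->].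
  rewrite big1 // => -[u v] /=; rewrite inE => /andP[uA vA].
  by apply/eqP; rewrite eqb0; apply/eqP => euv; apply: nb; exists u, v.
rewrite exchange_big [RHS]pair_big_dep /=; apply: eq_big => [[u v]|[u v] _] //=.
by rewrite /multiplicity -sum1dep_card [RHS]big_mkcond.
Qed.

Lemma degreeE (G : multigraph) (u : vertex G) :
  degree u = \sum_v multiplicity u v.
Proof.
rewrite -boundary1 card_boundary big_set1 [RHS](bigD1 u) //= multiplicity_diag.
by apply: eq_bigl => v; rewrite !inE.
Qed.

Lemma boundaryC (G : multigraph) (A : {set vertex G}) :
  boundary (~: A) = boundary A.
Proof.
apply/setP=> e; case: (ends_pair e) => x [y] [_ exy].
by rewrite !(boundary_pair _ exy) !inE addNb addbN negbK.
Qed.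

(** The inequality holds edge by edge: an edge leaving the intersection or the
    union leaves [A] or [B], and an edge leaving both the intersection and the
    union leaves both [A] and [B]. *)
Lemma boundary_submod (G : multigraph) (A B : {set vertex G}) :
  #|boundary (A :&: B)| + #|boundary (A :|: B)| <=
    #|boundary A| + #|boundary B|.
Proof.
rewrite -!sum1_card ![\sum_(_ in _) _]big_mkcond -!big_split /=.
apply: leq_sum => e _; case: (ends_pair e) => x [y] [_ exy].
rewrite !(boundary_pair _ exy) !inE.
by case: (x \in A) (y \in A) (x \in B) (y \in B) => [] [] [] [].
Qed.

Lemma boundary_aut (G : multigraph) (s : {perm (vertex G)})
    (A : {set vertex G}) :
  automorphism s -> #|boundary (s @: A)| = #|boundary A|.
Proof.
move=> aut_s; have s_inj := @perm_inj _ s.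
rewrite !card_boundary (reindex_inj s_inj) /=; apply: eq_big => [u|u _].
  by rewrite mem_imset.
rewrite (reindex_inj s_inj) /=; apply: eq_big => [v|v _]; last exact: aut_s.
by rewrite !inE mem_imset.
Qed.

Lemma degree_aut (G : multigraph) (s : {perm (vertex G)}) (v : vertex G) :
  automorphism s -> degree (s v) = degree v.
Proof. by move=> aut_s; rewrite -!boundary1 -imset_set1 boundary_aut. Qed.

Lemma connected_closed (G : multigraph) (A : {set vertex G}) :
  connected G -> A != set0 -> boundary A = set0 -> A = setT.
Proof.
case/andP=> _ /forallP Gc /set0Pn[x xA] bA0; apply/setP=> y; rewrite inE.
rewrite -xA; symmetry; apply: closed_connect (forallP (Gc x) y) => u v.
case/multiplicity_gt0P => e euv; apply/eqP; rewrite -negb_add.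
by rewrite -(boundary_pair A euv) bA0 inE.
Qed.

(** * Edge-connectivity as a minimum over cuts *)

Definition nontrivial (T : finType) (A : {set T}) : bool :=
  (A != set0) && (A != setT).

Lemma bigmin_leq (I : finType) (P : pred I) (F : I -> nat) n i :
  P i -> \big[minn/n]_(j | P j) F j <= F i.
Proof.
move=> Pi; have := mem_index_enum i; elim: (index_enum I) => // j r IH.
rewrite inE big_cons => /predU1P[<-|/IH le]; first by rewrite Pi geq_minl.
by case: ifP => // _; rewrite geq_min le orbT.
Qed.

(** No edge of the remaining multigraph leaves [A]. *)
Lemma boundary_disconnects (G : multigraph) (A : {set vertex G}) :
  nontrivial A -> ~~ connected (delete_edges (boundary A)).
Proof.
case/andP=> A0 AT; apply: contraNN AT => conn.
apply/eqP/(@connected_closed (delete_edges (boundary A))) => //.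
apply/setP=> e; rewrite [RHS]inE; apply/negP => eb.
by have := valP e; rewrite /= inE; move: eb; rewrite inE /= => ->.
Qed.

(** The component of a vertex that does not reach every other one is a suitable
    [A], since an edge leaving it must have been deleted. *)
Lemma disconnected_boundary (G : multigraph) (F : {set edge G}) :
  0 < #|vertex G| -> ~~ connected (delete_edges F) ->
  exists2 A : {set vertex G}, nontrivial A & #|boundary A| <= #|F|.
Proof.
move=> G0; rewrite /connected G0 /=; case/forallPn => u /forallPn[v nuv].
pose A : {set vertex G} := [set x | connect (@adjacent (delete_edges F)) u x].
have uA : u \in A by rewrite inE connect0.
exists A.
  apply/andP; split; first by apply/set0Pn; exists u.
  by apply: contraNneq nuv => AT; have := in_setT v; rewrite -AT inE.
apply/subset_leq_card/subsetP => e /boundaryP[x [y [xA yA exy]]].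
apply: contraNT yA => eF; move: xA; rewrite !inE => xA.
apply: connect_trans xA _.
by apply/connect1/multiplicity_gt0P; exists (exist _ e eF).
Qed.

Lemma edge_connectivity_leq (G : multigraph) (A : {set vertex G}) :
  nontrivial A -> edge_connectivity G <= #|boundary A|.
Proof.
move/boundary_disconnects => nc.
exact: (bigmin_leq (fun F : {set edge G} => #|F|) _ nc).
Qed.

(** The neutral value of the minimum defining the edge-connectivity is itself
    the size of a disconnecting set, namely the set of all edges; a nontrivial
    set supplies the two vertices that this needs. *)
Lemma edge_connectivity_attained (G : multigraph) (A : {set vertex G}) :
  nontrivial A -> exists2 B : {set vertex G},
    nontrivial B & #|boundary B| <= edge_connectivity G.
Proof.
move=> ntA; have /andP[/set0Pn[x _] _] := ntA.
have G0 : 0 < #|vertex G| by apply/card_gt0P; exists x.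
suff [F ncF <-] : exists2 F : {set edge G},
    ~~ connected (delete_edges F) & #|F| = edge_connectivity G.
  exact: disconnected_boundary.
apply: (big_ind (fun n => exists2 F : {set edge G},
  ~~ connected (delete_edges F) & #|F| = n)) => [|m n|F ncF]; last by exists F.
- exists setT; last by rewrite cardsT.
  have /andP[A0 AT] := ntA; apply: contraNN AT => conn.
  apply/eqP/(@connected_closed (delete_edges [set: edge G])) => //.
  by apply/setP=> e; have := valP e; rewrite inE.
- by rewrite /minn; case: ifP.
Qed.

(** * Atoms *)

Definition min_cut (G : multigraph) (A : {set vertex G}) : Prop :=
  nontrivial A /\
  forall B : {set vertex G}, nontrivial B -> #|boundary A| <= #|boundary B|.

Definition atom (G : multigraph) (A : {set vertex G}) : Prop :=
  min_cut A /\ forall B : {set vertex G}, min_cut B -> #|A| <= #|B|.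

Lemma min_cut_leq (G : multigraph) (A B : {set vertex G}) :
  min_cut A -> nontrivial B -> #|boundary B| <= #|boundary A| -> min_cut B.
Proof.
by case=> _ minA ntB BA; split=> // C /minA; apply: leq_trans.
Qed.

Lemma nontrivialC (T : finType) (A : {set T}) : nontrivial (~: A) = nontrivial A.
Proof.
rewrite /nontrivial andbC; congr (~~ _ && ~~ _).
  by rewrite -setC0 (inj_eq (@setC_inj T)).
by rewrite -setCT (inj_eq (@setC_inj T)).
Qed.

Lemma nontrivial_aut (T : finType) (s : {perm T}) (A : {set T}) :
  nontrivial (s @: A) = nontrivial A.
Proof.
rewrite /nontrivial imset_eq0; congr (_ && ~~ _).
by rewrite !eqEcard !subsetT /= card_imset //; apply: perm_inj.
Qed.

Lemma atom_exists (G : multigraph) (A0 : {set vertex G}) :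
  nontrivial A0 -> exists A : {set vertex G}, atom A.
Proof.
move=> nt0.
case: (arg_minnP (fun A : {set vertex G} => #|boundary A|) nt0) => A1 nt1 min1.
pose P (A : {set vertex G}) := nontrivial A && (#|boundary A| <= #|boundary A1|).
have P1 : P A1 by rewrite /P nt1 leqnn.
case: (arg_minnP (fun A : {set vertex G} => #|A|) P1) => A /andP[ntA leA] minA.
exists A; split=> [|B [ntB minB]]; last by apply: minA; rewrite /P ntB minB.
by apply: min_cut_leq leA.
Qed.

Lemma min_cut_aut (G : multigraph) (s : {perm (vertex G)}) (A : {set vertex G}) :
  automorphism s -> min_cut A -> min_cut (s @: A).
Proof.
move=> aut_s mcA; apply: (min_cut_leq mcA).
  by rewrite nontrivial_aut; case: mcA.
by rewrite boundary_aut.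
Qed.

Lemma atom_aut (G : multigraph) (s : {perm (vertex G)}) (A : {set vertex G}) :
  automorphism s -> atom A -> atom (s @: A).
Proof.
move=> aut_s [mcA minA]; split; first exact: min_cut_aut.
by move=> B /minA; rewrite card_imset //; apply: perm_inj.
Qed.

(** Complements of minimum cuts are minimum cuts, so an atom has at most half of
    the vertices and two atoms that meet cannot cover the vertex set.  Both their
    union and their intersection are then nontrivial, and submodularity makes the
    intersection a minimum cut too, as large as an atom. *)
Lemma atoms_meet_eq (G : multigraph) (A B : {set vertex G}) (x : vertex G) :
  atom A -> atom B -> x \in A -> x \in B -> A = B.
Proof.
move=> [mcA minA] [mcB minB] xA xB.
have cardAB : #|A| = #|B| by apply/eqP; rewrite eqn_leq minA ?minB.
have [[ntA leA] [ntB leB]] := (mcA, mcB).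
have ltAT : A != setT by case/andP: ntA.
have half : #|A| + #|B| <= #|vertex G|.
  rewrite -(cardsC A) leq_add2l -cardAB; apply: minA.
  by apply: (min_cut_leq mcA); rewrite ?nontrivialC ?boundaryC.
have AB0 : A :&: B != set0 by apply/set0Pn; exists x; rewrite inE xA.
have ABT : A :|: B != setT.
  apply: contraTneq half => ABT; rewrite -cardsUI ABT cardsT -ltnNge.
  by rewrite -addn1 leq_add2l card_gt0.
have ntI : nontrivial (A :&: B).
  rewrite /nontrivial AB0; apply: contraNneq ABT => /setP ABT.
  by apply/eqP/setP=> y; have := ABT y; rewrite !inE => /andP[->].
have ntU : nontrivial (A :|: B).
  by rewrite /nontrivial ABT andbT; apply/set0Pn; exists x; rewrite inE xA.
have mcI : min_cut (A :&: B).
  apply: (min_cut_leq mcA) => //.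
  rewrite -(leq_add2r #|boundary (A :|: B)|).
  apply: leq_trans (boundary_submod A B) _.
  by rewrite leq_add2l leB.
have /eqP AI : A :&: B == A by rewrite eqEcard subsetIl minA.
by apply/eqP; rewrite eqEcard cardAB leqnn andbT -AI subsetIr.
Qed.

Lemma atom_fixed (G : multigraph) (s : {perm (vertex G)}) (A : {set vertex G}) x :
  automorphism s -> atom A -> x \in A -> s x \in A -> s @: A = A.
Proof.
move=> aut_s atA xA sxA.
by apply: atoms_meet_eq (atom_aut aut_s atA) atA _ sxA; rewrite imset_f.
Qed.

(** For a set [W] of vertices that covers all edges and is contained in one orbit:
    if a vertex of [W] had its whole neighbourhood in its atom, so would all
    vertices of [W], every edge would lie inside an atom, and [A] would be a
    union of components of [G]. *)
Lemma atom_out_neighbour (G : multigraph) (A W : {set vertex G}) u :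
  connected G -> atom A -> aut_transitive_on W ->
  (forall e : edge G, ends e :&: W != set0) ->
  u \in A -> u \in W -> exists2 v, v \notin A & adjacent u v.
Proof.
move=> Gc atA trW cover uA uW.
case: (boolP [exists v, (v \notin A) && adjacent u v]) => [/existsP|none].
  by case=> v /andP[]; exists v.
have inA v : adjacent u v -> v \in A.
  by move=> uv; apply: contraNT none => vA; apply/existsP; exists v; rewrite vA.
have star w : w \in W -> exists B, [/\ atom B, w \in B
    & forall v, adjacent w v -> v \in B].
  case/(trW _ _ uW) => s aut_s <-; exists (s @: A); split.
  - exact: atom_aut.
  - by rewrite imset_f.
  - move=> v; rewrite -(permKV s v) /adjacent aut_s => /inA vA.
    exact: imset_f.
have edge_in_atom (e : edge G) : exists2 B, atom B & ends e \subset B.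
  have /set0Pn[w /setIP[we /star[B [atB wB nbB]]]] := cover e.
  exists B => //; apply/subsetP=> v ve; case: (eqVneq v w) => [->//|vw].
  apply/nbB/multiplicity_gt0P; exists e; apply/eqP; rewrite eq_sym eqEcard.
  by rewrite subUset !sub1set we ve /= (eqP (card_ends e)) cards2 eq_sym vw.
have [[/andP[A0 /eqP AT] _] _] := atA; case: AT.
apply: connected_closed => //; apply/setP=> e; rewrite [RHS]inE.
apply/negP=> /boundaryP[x [y [xA yA exy]]].
have [B atB] := edge_in_atom e; rewrite exy subUset !sub1set => /andP[xB yB].
by rewrite (atoms_meet_eq atA atB xA xB) yB in yA.
Qed.

(** * Induced multigraphs *)

Lemma multiplicity_induced (G : multigraph) (A : {set vertex G})
    (x y : vertex (induced A)) :
  multiplicity x y = multiplicity (val x) (val y).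
Proof.
rewrite /multiplicity -(card_imset _ val_inj); apply: eq_card => e.
rewrite [RHS]inE; apply/imsetP/eqP => [[f]|exy].
  rewrite inE => /eqP/setP fxy ->; apply/setP=> z; rewrite !inE.
  case: (boolP (z \in A)) => [zA|zA].
    by have := fxy (exist _ z zA); rewrite !inE -!val_eqE.
  have := contraNN (subsetP (valP f) z) zA.
  move/negbTE ->; apply/esym/norP; split; apply: contraNneq zA => ->;
    exact: valP.
have eA : ends e \subset A by rewrite exy subUset !sub1set (valP x) (valP y).
exists (exist _ e eA) => //; rewrite inE; apply/eqP/setP=> z.
by rewrite !inE /= exy !inE !val_eqE.
Qed.

Lemma degree_split (G : multigraph) (A : {set vertex G})
    (x : vertex (induced A)) :
  degree (val x) = degree x + \sum_(v in ~: A) multiplicity (val x) v.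
Proof.
rewrite !degreeE (bigID (mem A)) /=; congr (_ + _).
  by rewrite big_sub /=; apply: eq_bigr => y _; rewrite multiplicity_induced.
by apply: eq_bigl => v; rewrite inE.
Qed.

(** Each vertex of [A] sends to the complement of [A] exactly the edges that it
    loses when passing to the induced multigraph. *)
Lemma card_boundary_induced (G : multigraph) (V1 V2 A : {set vertex G})
    (d1 d2 d1' d2' : nat) :
  bipartition V1 V2 ->
  (forall v, v \in V1 -> degree v = d1) ->
  (forall v, v \in V2 -> degree v = d2) ->
  (forall v : vertex (induced A), v \in trace A V1 -> degree v = d1') ->
  (forall v : vertex (induced A), v \in trace A V2 -> degree v = d2') ->
  #|boundary A| = #|V1 :&: A| * (d1 - d1') + #|V2 :&: A| * (d2 - d2').
Proof.
case=> _ _ dis cov _ deg1 deg2 deg1' deg2'.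
have out (V : {set vertex G}) d d' v : (forall v, v \in V -> degree v = d) ->
    (forall v : vertex (induced A), v \in trace A V -> degree v = d') ->
    v \in V :&: A -> \sum_(w in ~: A) multiplicity v w = d - d'.
  move=> deg deg' /setIP[vV vA]; pose x : vertex (induced A) := exist _ v vA.
  rewrite -(deg v vV) -(deg' x) ?inE //.
  by rewrite [degree v](degree_split x) addKn.
rewrite card_boundary (big_setID V1) /= setIC -!sum_nat_const; congr (_ + _).
  by apply: eq_bigr => v; apply: out.
have -> : A :\: V1 = V2 :&: A.
  apply/setP=> v; rewrite !inE; congr (_ && _).
  have := in_setT v; rewrite -cov inE.
  case v1: (v \in V1) => /=; last by move->.
  by rewrite (disjointFr dis v1).
by apply: eq_bigr => v; apply: out.
Qed.

(** A component of the induced multigraph has a boundary contained in that of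
    the atom, so it is a minimum cut and cannot be smaller than the atom. *)
Lemma atom_induced_connected (G : multigraph) (A : {set vertex G}) :
  atom A -> connected (induced A).
Proof.
move=> [mcA minA]; have [/andP[/set0Pn[a aA] AT] _] := mcA.
rewrite /connected; apply/andP; split.
  by apply/card_gt0P; exists (exist _ a aA).
apply/forallP=> u; apply/forallP=> v.
pose C := [set val x | x in [pred x | connect (@adjacent (induced A)) u x]].
have CA : C \subset A by apply/subsetP=> _ /imsetP[x _ ->]; apply: valP.
suff /eqP CeA : C == A.
  have : val v \in C by rewrite CeA; apply: valP.
  by case/imsetP=> w uw /val_inj ->; apply: uw.
have ntC : nontrivial C.
  apply/andP; split.
    by apply/set0Pn; exists (val u); apply: imset_f; apply: connect0.
  by apply: contraNneq AT => CT; rewrite -subTset -CT.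
rewrite eqEcard CA minA //; apply: (min_cut_leq mcA) => //.
apply/subset_leq_card/subsetP => e /boundaryP[x [y [xC yC exy]]].
apply/boundaryP; exists x, y; split=> //; first exact: (subsetP CA).
apply: contraNN yC => yA; case/imsetP: xC => x' ux' xE.
apply/imsetP; exists (exist _ y yA) => //; apply: (connect_trans ux').
apply: connect1; rewrite /adjacent multiplicity_induced -xE.
by apply/multiplicity_gt0P; exists e.
Qed.

Lemma aut_restrict (G : multigraph) (A : {set vertex G}) (s : {perm (vertex G)}) :
  automorphism s -> s @: A = A ->
  exists2 t : {perm (vertex (induced A))},
    automorphism t & forall x, val (t x) = s (val x).
Proof.
move=> aut_s sA.
have stable x : x \in A -> s x \in A by move=> xA; rewrite -sA imset_f.
pose f (x : vertex (induced A)) : vertex (induced A) :=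
  exist _ (s (val x)) (stable _ (valP x)).
have f_inj : injective f.
  by move=> x y /(congr1 val) /= /perm_inj /val_inj.
exists (perm f_inj) => [x y|x]; last by rewrite permE.
by rewrite !multiplicity_induced !permE aut_s.
Qed.

Lemma atom_aut_transitive (G : multigraph) (A W : {set vertex G}) :
  atom A -> aut_transitive_on W -> aut_transitive_on (trace A W).
Proof.
move=> atA trW u v; rewrite !inE => uW vW.
have [s aut_s suv] := trW _ _ uW vW.
have sA : s @: A = A.
  by apply: (@atom_fixed _ s A (val u)); rewrite ?suv; try exact: valP.
have [t aut_t tE] := aut_restrict aut_s sA.
by exists t => //; apply: val_inj; rewrite tE.
Qed.

Lemma bipartition_induced (G : multigraph) (V1 V2 A : {set vertex G}) :
  bipartition V1 V2 -> V1 :&: A != set0 -> V2 :&: A != set0 ->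
  bipartition (trace A V1) (trace A V2).
Proof.
case=> _ _ dis cov bip A1 A2.
have nonempty (V : {set vertex G}) : V :&: A != set0 -> trace A V != set0.
  case/set0Pn=> x /setIP[xV xA]; apply/set0Pn; exists (exist _ x xA).
  by rewrite inE.
have one (V : {set vertex G}) (e : edge (induced A)) :
    #|ends e :&: trace A V| = #|ends (val e) :&: V|.
  rewrite -(card_imset _ val_inj); apply: eq_card => x.
  apply/imsetP/setIP => [[y]|[xe xV]]; first by rewrite !inE => /andP[? ?] ->.
  by exists (exist _ x (subsetP (valP e) x xe)); rewrite ?inE /= ?xe.
split; try exact: nonempty.
- apply/pred0P=> x /=; rewrite !inE; apply/negP=> /andP[x1].
  by rewrite (disjointFr dis x1).
- by apply/setP=> x; have := in_setT (val x); rewrite -cov !inE.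
- by move=> e; rewrite !one; apply: bip.
Qed.

Lemma transitive_degree (G : multigraph) (W : {set vertex G}) :
  W != set0 -> aut_transitive_on W ->
  exists d, forall v, v \in W -> degree v = d.
Proof.
case/set0Pn=> u uW trW; exists (degree u) => v vW.
by have [s aut_s <-] := trW u v uW vW; rewrite degree_aut.
Qed.

(** * Bipartite multigraphs with constant degrees on each part *)

Lemma bipartition_sym (G : multigraph) (V1 V2 : {set vertex G}) :
  bipartition V1 V2 -> bipartition V2 V1.
Proof.
case=> V10 V20 dis cov bip; split=> //; first by rewrite disjoint_sym.
  by rewrite setUC.
by move=> e; have [] := bip e.
Qed.

Lemma bipartition_cover (G : multigraph) (V1 V2 : {set vertex G}) (e : edge G) :
  bipartition V1 V2 -> ends e :&: V1 != set0.
Proof. by case=> _ _ _ _ /(_ e)[e1 _]; rewrite -card_gt0 e1. Qed.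

Lemma nontrivial1 (G : multigraph) (V1 V2 : {set vertex G}) x :
  bipartition V1 V2 -> x \in V1 -> nontrivial [set x].
Proof.
case=> _ /set0Pn[y y2] dis _ _ x1; apply/andP; split.
  by apply/set0Pn; exists x; rewrite inE.
apply: contraTneq y2 => xT; have := in_setT y; rewrite -xT inE => /eqP ->.
by rewrite (disjointFr dis x1).
Qed.

(** A set lying inside one part is independent, so every edge at any of its
    vertices is in the boundary. *)
Lemma small_boundary_meets (G : multigraph) (V1 V2 A : {set vertex G}) d1 :
  bipartition V1 V2 -> (forall v, v \in V1 -> degree v = d1) ->
  A != set0 -> #|boundary A| < d1 -> V2 :&: A != set0.
Proof.
move=> bip deg1 /set0Pn[x xA]; apply: contraTneq => A2; rewrite -leqNgt.
have notV2 z : z \in A -> z \notin V2.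
  by move=> zA; apply/negP=> z2; have := in_set0 z; rewrite -A2 inE z2 zA.
have [_ _ _ cov _] := bip; have := in_setT x.
rewrite -cov inE (negbTE (notV2 x xA)) orbF => x1.
rewrite -(deg1 x x1) -boundary1; apply/subset_leq_card/subsetP => e.
case/boundaryP=> _ [y [/set1P-> _ exy]].
have := bipartition_cover e (bipartition_sym bip).
case/set0Pn=> z /setIP[ze z2]; rewrite inE; apply/andP; split.
  by apply: contraL z2 => /subsetP/(_ z ze)/notV2.
by apply/pred0Pn; exists x; rewrite /= xA exy !inE eqxx.
Qed.

Lemma min_degreeE (G : multigraph) (V1 V2 : {set vertex G}) (d1 d2 : nat) :
  bipartition V1 V2 ->
  (forall v, v \in V1 -> degree v = d1) ->
  (forall v, v \in V2 -> degree v = d2) ->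
  min_degree G = minn d1 d2.
Proof.
case=> /set0Pn[x x1] /set0Pn[y y2] _ cov _ deg1 deg2.
apply/eqP; rewrite eqn_leq leq_min -{1}(deg1 x x1) -{1}(deg2 y y2).
rewrite !bigmin_leq //=.
apply: (big_ind (fun n => minn d1 d2 <= n)) => [|m n lm ln|v _].
- by rewrite -(deg1 x x1) geq_min max_card.
- by rewrite leq_min lm.
- have := in_setT v; rewrite -cov inE geq_min.
  by case/orP=> [/deg1|/deg2] ->; rewrite leqnn ?orbT.
Qed.

(** * Multigraphs that are not maximally edge-connected *)

Theorem theorem3p2 (G : multigraph) (V1 V2 : {set vertex G}) (d1 d2 : nat)
    (Gconn : connected G) (Ght : half_transitive V1 V2)
    (deg1 : forall v : vertex G, v \in V1 -> degree v = d1)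
    (deg2 : forall v : vertex G, v \in V2 -> degree v = d2) :
  ~ maximally_edge_connected G <->
  exists (A : {set vertex G}) (d1' d2' : nat),
    let A1 := V1 :&: A in
    let A2 := V2 :&: A in
    [/\ A \proper [set: vertex G], A1 != set0 & A2 != set0] /\
    [/\ connected (induced A),
        half_transitive (trace A V1) (trace A V2),
        forall v : vertex (induced A), v \in trace A V1 -> degree v = d1'
      & forall v : vertex (induced A), v \in trace A V2 -> degree v = d2'] /\
    [/\ d1' < d1, d2' < d2
      & #|A1| * (d1 - d1') + #|A2| * (d2 - d2') <= minn d1 d2 - 1].
Proof.
have [bip tr1 tr2] := Ght; have bip' := bipartition_sym bip.
have minE := min_degreeE bip deg1 deg2.
split=> [nmax|[A [d1' [d2' /=]]]]; last first.
  case=> [[ltA /set0Pn[x /setIP[x1 xA]] A2]].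
  case=> [[_ _ deg1' deg2'] [lt1 lt2 small]].
  have ntA : nontrivial A.
    by rewrite /nontrivial -properT ltA andbT; apply/set0Pn; exists x.
  have min_gt0 : 0 < minn d1 d2.
    by rewrite leq_min (leq_ltn_trans _ lt1) // (leq_ltn_trans _ lt2).
  move=> maxG; have := edge_connectivity_leq ntA.
  rewrite maxG minE (card_boundary_induced bip deg1 deg2 deg1' deg2').
  by move/leq_trans/(_ small); rewrite leqNgt subn1 ltn_predL min_gt0.
have [/set0Pn[x x1] /set0Pn[y y2] _ _ _] := bip.
have ntx := nontrivial1 bip x1; have nty := nontrivial1 bip' y2.
have ec_lt : edge_connectivity G < minn d1 d2.
  rewrite ltn_neqAle -{1}minE; apply/andP; split; first exact/eqP.
  rewrite leq_min -(deg1 x x1) -(deg2 y y2) -!boundary1.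
  by rewrite !edge_connectivity_leq.
have [A atA] := atom_exists ntx; have [[ntA minA] _] := atA.
have cut_lt : #|boundary A| < minn d1 d2.
  have [B ntB leB] := edge_connectivity_attained ntx.
  exact: leq_ltn_trans (leq_trans (minA B ntB) leB) ec_lt.
have [cut_lt1 cut_lt2] : #|boundary A| < d1 /\ #|boundary A| < d2.
  by apply/andP; rewrite -leq_min.
have [A0 AT] := andP ntA.
have A1 := small_boundary_meets bip' deg2 A0 cut_lt2.
have A2 := small_boundary_meets bip deg1 A0 cut_lt1.
have bipA := bipartition_induced bip A1 A2.
have [t1 t2 _ _ _] := bipA.
have trA1 := atom_aut_transitive atA tr1.
have trA2 := atom_aut_transitive atA tr2.
have [d1' deg1'] := transitive_degree t1 trA1.
have [d2' deg2'] := transitive_degree t2 trA2.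
have strict (V V' : {set vertex G}) d d' : bipartition V V' ->
    aut_transitive_on V -> (forall v, v \in V -> degree v = d) ->
    trace A V != set0 ->
    (forall v : vertex (induced A), v \in trace A V -> degree v = d') -> d' < d.
  move=> bipV trV degV /set0Pn[u uV] degA.
  have uV' : val u \in V by rewrite inE in uV.
  rewrite -(degV _ uV') -(degA u uV) degree_split -addn1 leq_add2l.
  have cover e := bipartition_cover e bipV.
  have [v vA uv] := atom_out_neighbour Gconn atA trV cover (valP u) uV'.
  by rewrite (bigD1 v) ?inE //= addn_gt0 -/(adjacent (val u) v) uv.
exists A, d1', d2'; split; first by split; rewrite ?properT.
split; first by split=> //; apply: atom_induced_connected.
split; [exact: (strict _ _ _ _ bip)|exact: (strict _ _ _ _ bip')|].
rewrite -(card_boundary_induced bip deg1 deg2 deg1' deg2').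
by rewrite subn1 -ltnS prednK // (leq_ltn_trans _ cut_lt).
Qed.
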